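(* Let $H$ be a Hopf algebra over a commutative unital integral domain $R$, let $\Pi$ be a finite subgroup of weights of $H$, and let $g\in H$ be grouplike. If $g\in G(H)\setminus G_\Pi(H)$ then $\Sigma_\Pi(g)=0$. If $g\in G_\Pi(H)$, then $\Sigma_\Pi(g)=|\Pi|$.
   Context: A weight of $H$ is an $R$-algebra homomorphism $H\to R$. The set $\Gamma_H$ of weights is a group under convolution $(\lambda*\nu)(h)=(\lambda\otimes\nu)(\Delta(h))$, with identity the counit $\varepsilon$ and inverse $\lambda^{-1}=\lambda\circ S$. $\Pi\subset\Gamma_H$ is a finite subgroup, and $\Sigma_\Pi:=\sum_{\gamma\in\Pi}\gamma:H\to R$. $G(H)$ is the group of grouplike elements ($\Delta(g)=g\otimes g$, $\varepsilon(g)=1$), and $G_\Pi(H)=\{g\in G(H):\gamma(g)=1\ \forall\gamma\in\Pi\}$. The integer $|\Pi|$ is viewed in $R$ via $\mathbb Z\to R$. *)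

(* Defs.v *)
From HB Require Import structures.
From mathcomp Require Import all_boot all_algebra finmap.
From mathcomp Require Import boolp classical_sets.
From mathcomp Require Import ring.

Set Implicit Arguments.
Unset Strict Implicit.
Unset Printing Implicit Defensive.

Import GRing.Theory.
Local Open Scope quotient_scope.
Local Open Scope ring_scope.

Reserved Notation "u '⊗' v" (at level 40, left associativity).
Reserved Notation "U '⨂' V" (at level 40, left associativity).

Section TensorType.
Context (R : comNzRingType) (U V : lmodType R).

(* A sequence of pairs stands for the formal sum of the pure tensors u ⊗ v.   *)
(* Since -(u ⊗ v) = (- u) ⊗ v and a (u ⊗ v) = (a u) ⊗ v, such sums suffice    *)
(* and U ⨂ V is the quotient of the free commutative monoid on U * V by the   *)
(* congruence generated by bilinearity. The universal property is             *)
(* tlift_tens, tliftP and tens_lin_inj below.                                 *)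
Inductive tens_rel : seq (U * V) -> seq (U * V) -> Prop :=
| tens_refl s : tens_rel s s
| tens_sym s t : tens_rel s t -> tens_rel t s
| tens_trans t s r : tens_rel s t -> tens_rel t r -> tens_rel s r
| tens_cat s s' t t' :
    tens_rel s s' -> tens_rel t t' -> tens_rel (s ++ t) (s' ++ t')
| tens_catC s t : tens_rel (s ++ t) (t ++ s)
| tens_0l v : tens_rel [:: (0, v)] [::]
| tens_Dl u u' v : tens_rel [:: (u + u', v)] [:: (u, v); (u', v)]
| tens_Dr u v v' : tens_rel [:: (u, v + v')] [:: (u, v); (u, v')]
| tens_Z a u v : tens_rel [:: (a *: u, v)] [:: (u, a *: v)].

Definition tens_eqb (s t : seq (U * V)) : bool := `[< tens_rel s t >].

Fact tens_eqb_refl : reflexive tens_eqb.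
Proof. by move=> s; apply/asboolP; apply: tens_refl. Qed.
Fact tens_eqb_sym : symmetric tens_eqb.
Proof. by move=> s t; apply/asboolP/asboolP; apply: tens_sym. Qed.
Fact tens_eqb_trans : transitive tens_eqb.
Proof.
by move=> t s r /asboolP st /asboolP tr; apply/asboolP; apply: tens_trans tr.
Qed.

Canonical tens_equiv :=
  EquivRel tens_eqb tens_eqb_refl tens_eqb_sym tens_eqb_trans.

Definition tensor := {eq_quot tens_equiv}.
HB.instance Definition _ := Choice.on tensor.
HB.instance Definition _ := EqQuotient.on tensor.

Definition tpi (s : seq (U * V)) : tensor := \pi_tensor s.
Definition tens (u : U) (v : V) : tensor := tpi [:: (u, v)].

Lemma tpiP s t : tens_rel s t <-> tpi s = tpi t.
Proof.
split=> [st|]; first by apply/eqmodP/asboolP.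
by move/eqmodP/asboolP.
Qed.

Lemma tpi_repr (t : tensor) : tpi (repr t) = t.
Proof. exact: reprK. Qed.

Lemma repr_tpi s : tens_rel (repr (tpi s)) s.
Proof. by apply/tpiP; rewrite tpi_repr. Qed.

Definition tscale_seq (a : R) (s : seq (U * V)) : seq (U * V) :=
  [seq (a *: p.1, p.2) | p <- s].

Lemma tscale_rel a s t :
  tens_rel s t -> tens_rel (tscale_seq a s) (tscale_seq a t).
Proof.
elim=> {s t}.
- by move=> s; apply: tens_refl.
- by move=> s t _; apply: tens_sym.
- by move=> t s r _ st _; apply: tens_trans.
- by move=> s s' t t' _ h _ h'; rewrite /tscale_seq !map_cat; apply: tens_cat.
- by move=> s t; rewrite /tscale_seq !map_cat; apply: tens_catC.
- by move=> v; rewrite /= scaler0; apply: tens_0l.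
- by move=> u u' v; rewrite /= scalerDr; apply: tens_Dl.
- by move=> u v v'; apply: tens_Dr.
- by move=> b u v; rewrite /= scalerA mulrC -scalerA; apply: tens_Z.
Qed.

Definition tadd (s t : tensor) : tensor := tpi (repr s ++ repr t).
Definition tscale (a : R) (t : tensor) : tensor := tpi (tscale_seq a (repr t)).
Definition topp (t : tensor) : tensor := tscale (-1) t.

Lemma tadd_pi s t : tadd (tpi s) (tpi t) = tpi (s ++ t).
Proof. by apply/tpiP; apply: tens_cat; apply: repr_tpi. Qed.

Lemma tscale_pi a s : tscale a (tpi s) = tpi (tscale_seq a s).
Proof. by apply/tpiP; apply: tscale_rel; apply: repr_tpi. Qed.

Lemma tpi_ind (P : tensor -> Prop) : (forall s, P (tpi s)) -> forall t, P t.
Proof. by move=> h t; rewrite -(tpi_repr t). Qed.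

Fact taddA : associative tadd.
Proof.
by elim/tpi_ind=> r; elim/tpi_ind=> s; elim/tpi_ind=> t; rewrite !tadd_pi catA.
Qed.

Fact taddC : commutative tadd.
Proof.
elim/tpi_ind=> s; elim/tpi_ind=> t; rewrite !tadd_pi.
by apply/tpiP; apply: tens_catC.
Qed.

Fact tadd0 : left_id (tpi [::]) tadd.
Proof. by elim/tpi_ind=> s; rewrite tadd_pi. Qed.

Fact tscaleDl t a b : tscale (a + b) t = tadd (tscale a t) (tscale b t).
Proof.
elim/tpi_ind: t; elim=> [|[u v] s IHs].
  by rewrite !tscale_pi tadd_pi.
rewrite -cat1s -tadd_pi.
have hZ c : tscale c (tadd (tpi [:: (u, v)]) (tpi s)) =
            tadd (tscale c (tpi [:: (u, v)])) (tscale c (tpi s)).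
  by rewrite tadd_pi !tscale_pi tadd_pi /tscale_seq map_cat.
rewrite !hZ IHs !taddA; congr tadd.
rewrite -[RHS]taddA [tadd (tscale a (tpi s)) _]taddC taddA; congr tadd.
rewrite !tscale_pi tadd_pi; apply/tpiP => /=.
by rewrite scalerDl; apply: tens_Dl.
Qed.

Fact tscale0 t : tscale 0 t = tpi [::].
Proof.
elim/tpi_ind: t => s; rewrite tscale_pi; apply/tpiP.
elim: s => [|[u v] s IHs] /=; first exact: tens_refl.
rewrite -cat1s -[[::]]cats0; apply: tens_cat IHs.
by rewrite scale0r; apply: tens_0l.
Qed.

Fact tscale1 : left_id 1 tscale.
Proof.
elim/tpi_ind=> s; rewrite tscale_pi /tscale_seq.
by rewrite (eq_map (g := id)) ?map_id // => -[u v] /=; rewrite scale1r.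
Qed.

Fact taddN : left_inverse (tpi [::]) topp tadd.
Proof. by move=> t; rewrite -{2}[t]tscale1 -tscaleDl addNr tscale0. Qed.

HB.instance Definition _ := GRing.isZmodule.Build tensor taddA taddC tadd0 taddN.

Fact tscaleA a b t : tscale a (tscale b t) = tscale (a * b) t.
Proof.
elim/tpi_ind: t => s; rewrite !tscale_pi /tscale_seq -map_comp.
by congr tpi; apply: eq_map => -[u v] /=; rewrite scalerA.
Qed.

Fact tscaleDr : right_distributive tscale +%R.
Proof.
move=> a; elim/tpi_ind=> s; elim/tpi_ind=> t.
by rewrite /GRing.add /= tadd_pi !tscale_pi tadd_pi /tscale_seq map_cat.
Qed.

HB.instance Definition _ := GRing.Zmodule_isLmodule.Build R tensor
  tscaleA tscale1 tscaleDr (fun t => tscaleDl t).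

Lemma tpiD s t : tpi s + tpi t = tpi (s ++ t).
Proof. exact: tadd_pi. Qed.

Lemma tpiZ a s : a *: tpi s = tpi (tscale_seq a s).
Proof. exact: tscale_pi. Qed.

(* The linear map induced by f; meaningful only when f is bilinear. *)
Definition tlift (W : nmodType) (f : U -> V -> W) (t : tensor) : W :=
  \sum_(p <- repr t) f p.1 p.2.

End TensorType.

Notation "u ⊗ v" := (tens u v) : ring_scope.
Notation "U ⨂ V" := (tensor U V) : type_scope.

Notation bilin f := (bilinear_for *:%R *:%R f).

Section Bilinear.
Context (R : comNzRingType) (U V W : lmodType R) (f : U -> V -> W).
Hypothesis fb : bilin f.

Lemma bilinPl a u u' v : f (a *: u + u') v = a *: f u v + f u' v.
Proof. exact: fb.1. Qed.
Lemma bilinPr a u v v' : f u (a *: v + v') = a *: f u v + f u v'.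
Proof. exact: fb.2. Qed.
Lemma bilin0l v : f 0 v = 0.
Proof. by have := bilinPl (-1) 0 0 v; rewrite scaler0 addr0 scaleN1r addNr. Qed.
Lemma bilin0r u : f u 0 = 0.
Proof. by have := bilinPr (-1) u 0 0; rewrite scaler0 addr0 scaleN1r addNr. Qed.
Lemma bilinDl u u' v : f (u + u') v = f u v + f u' v.
Proof. by have := bilinPl 1 u u' v; rewrite !scale1r. Qed.
Lemma bilinDr u v v' : f u (v + v') = f u v + f u v'.
Proof. by have := bilinPr 1 u v v'; rewrite !scale1r. Qed.
Lemma bilinZl a u v : f (a *: u) v = a *: f u v.
Proof. by have := bilinPl a u 0 v; rewrite bilin0l !addr0. Qed.
Lemma bilinZr a u v : f u (a *: v) = a *: f u v.
Proof. by have := bilinPr a u v 0; rewrite bilin0r !addr0. Qed.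

End Bilinear.

Section TensorTheory.
Context (R : comNzRingType) (U V : lmodType R).

Lemma tens_bilin : bilin (@tens R U V).
Proof.
split=> [v a u u'|u a v v'].
  rewrite /= /tens tpiZ tpiD /=.
  by apply/tpiP; apply: tens_Dl.
rewrite /= /tens tpiZ tpiD /=.
apply/tpiP; apply: tens_trans (tens_Dr _ _ _) _.
rewrite -cat1s -[[:: (a *: u, v); _]]cat1s; apply: tens_cat (tens_refl _).
exact/tens_sym/tens_Z.
Qed.

Lemma tpi_sum (s : seq (U * V)) : tpi s = \sum_(p <- s) p.1 ⊗ p.2.
Proof.
elim: s => [|[u v] s IHs]; first by rewrite big_nil.
by rewrite big_cons -IHs /tens tpiD.
Qed.

Lemma tensorE (t : U ⨂ V) : t = \sum_(p <- repr t) p.1 ⊗ p.2.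
Proof. by rewrite -tpi_sum tpi_repr. Qed.

Lemma tensor_ind (P : U ⨂ V -> Prop) :
  P 0 -> (forall s t, P s -> P t -> P (s + t)) ->
  (forall u v, P (u ⊗ v)) -> forall t, P t.
Proof. by move=> P0 PD Pt t; rewrite (tensorE t); apply: big_ind. Qed.

Section Lift.
Context (W : lmodType R) (f : U -> V -> W) (fb : bilin f).

Lemma tlift_tpi s : tlift f (tpi s) = \sum_(p <- s) f p.1 p.2.
Proof.
suff inv s' t : tens_rel s' t ->
    \sum_(p <- s') f p.1 p.2 = \sum_(p <- t) f p.1 p.2.
  exact: inv (repr_tpi s).
elim=> {s s' t}.
- by [].
- by move=> s t _ ->.
- by move=> t s r _ -> _ ->.
- by move=> s s' t t' _ h _ h'; rewrite !big_cat /= h h'.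
- by move=> s t; rewrite !big_cat /= addrC.
- by move=> v; rewrite big_seq1 big_nil /= (bilin0l fb).
- by move=> u u' v; rewrite !big_cons !big_nil !addr0 /= (bilinDl fb).
- by move=> u v v'; rewrite !big_cons !big_nil !addr0 /= (bilinDr fb).
- by move=> a u v; rewrite !big_seq1 /= (bilinZl fb) (bilinZr fb).
Qed.

Lemma tlift_tens u v : tlift f (u ⊗ v) = f u v.
Proof. by rewrite tlift_tpi big_seq1. Qed.

Lemma tliftP : linear (tlift f).
Proof.
move=> a; elim/tpi_ind=> s; elim/tpi_ind=> t.
rewrite tpiZ tpiD !tlift_tpi.
rewrite big_cat big_map scaler_sumr /=; congr (_ + _).
by apply: eq_bigr => -[u v] _ /=; rewrite (bilinZl fb).
Qed.

Lemma tliftD : {morph tlift f : s t / s + t}.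
Proof. by move=> s t; have := tliftP 1 s t; rewrite !scale1r. Qed.
Lemma tlift0 : tlift f 0 = 0.
Proof.
by have := tliftP (-1) 0 0; rewrite scaler0 addr0 scaleN1r addNr.
Qed.
Lemma tliftZ a : {morph tlift f : t / a *: t}.
Proof. by move=> t; have := tliftP a t 0; rewrite !addr0 tlift0 addr0. Qed.
Lemma tlift_sum I (r : seq I) F :
  tlift f (\sum_(i <- r) F i) = \sum_(i <- r) tlift f (F i).
Proof. exact: (big_morph _ tliftD tlift0). Qed.

End Lift.

Lemma tens_lin_inj (W : lmodType R) (f g : {linear U ⨂ V -> W}) :
  (forall u v, f (u ⊗ v) = g (u ⊗ v)) -> f =1 g.
Proof.
move=> fg; elim/tensor_ind=> [|s t fs ft|//]; first by rewrite !linear0.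
by rewrite !linearD fs ft.
Qed.

Lemma eq_tlift (W : nmodType) (f g : U -> V -> W) :
  f =2 g -> tlift f =1 tlift g.
Proof. by move=> fg t; apply: eq_bigr. Qed.

Lemma linear_tlift (W W' : lmodType R) (f : U -> V -> W) (h : W -> W') t :
  linear h -> h (tlift f t) = tlift (fun u v => h (f u v)) t.
Proof.
move=> hl.
pose h' := GRing.isLinear.Build R W W' *:%R h hl.
exact: (linear_sum (HB.pack_for {linear W -> W'} h h')).
Qed.

End TensorTheory.

Definition tmap (R : comNzRingType) (U V U' V' : lmodType R)
    (f : U -> U') (g : V -> V') : U ⨂ V -> U' ⨂ V' :=
  tlift (fun u v => f u ⊗ g v).

Definition tassoc (R : comNzRingType) (U V W : lmodType R) :
    (U ⨂ V) ⨂ W -> U ⨂ (V ⨂ W) :=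
  tlift (fun t w => tlift (fun u v => u ⊗ (v ⊗ w)) t).

Section TensorAlgebra.
Context (R : comNzRingType) (A B : algType R).

Definition tmul (s t : A ⨂ B) : A ⨂ B :=
  tlift (fun a b => tlift (fun c d => (a * c) ⊗ (b * d)) t) s.

Let inner_bilin a b : bilin (fun (c : A) (d : B) => (a * c) ⊗ (b * d)).
Proof.
split=> [d x c c'|c x d d'].
  by rewrite /= mulrDr -scalerAr (tens_bilin A B).1.
by rewrite /= mulrDr -scalerAr (tens_bilin A B).2.
Qed.

Let outer_bilin t :
  bilin (fun a b => tlift (fun c d => (a * c) ⊗ (b * d)) t : A ⨂ B).
Proof.
split=> [b x a a'|a x b b']; rewrite /= /tlift scaler_sumr -big_split /=;
  apply: eq_bigr => -[c d] _ /=; rewrite mulrDl -scalerAl.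
  by rewrite (bilinPl (tens_bilin A B)).
by rewrite (bilinPr (tens_bilin A B)).
Qed.

Lemma tmul_tens a b c d : tmul (a ⊗ b) (c ⊗ d) = (a * c) ⊗ (b * d).
Proof. by rewrite /tmul tlift_tens ?tlift_tens. Qed.

Fact tmulDl : left_distributive tmul +%R.
Proof. by move=> r s t; rewrite /tmul tliftD. Qed.

Fact tmulDr : right_distributive tmul +%R.
Proof.
move=> r s t; rewrite /tmul /tlift -big_split /=.
by apply: eq_bigr => p _; have := tliftD (inner_bilin p.1 p.2) s t.
Qed.

Let tmul0l t : tmul 0 t = 0.
Proof. by apply: (@addrI _ (tmul 0 t)); rewrite -tmulDl !addr0. Qed.
Let tmul0r t : tmul t 0 = 0.
Proof. by apply: (@addrI _ (tmul t 0)); rewrite -tmulDr !addr0. Qed.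

Fact tmulA : associative tmul.
Proof.
move=> r s t; elim/tensor_ind: r => [|r r' hr hr'|a b].
- by rewrite !tmul0l.
- by rewrite !tmulDl hr hr'.
elim/tensor_ind: s => [|s s' hs hs'|c d].
- by rewrite !(tmul0l, tmul0r).
- by rewrite !(tmulDl, tmulDr) hs hs'.
elim/tensor_ind: t => [|t t' ht ht'|e f].
- by rewrite !tmul0r.
- by rewrite !tmulDr ht ht'.
by rewrite !tmul_tens !mulrA.
Qed.

Fact tmul1l : left_id (1 ⊗ 1) tmul.
Proof.
elim/tensor_ind=> [|s s' hs hs'|a b]; first exact: tmul0r.
  by rewrite tmulDr hs hs'.
by rewrite tmul_tens !mul1r.
Qed.

Fact tmul1r : right_id (1 ⊗ 1) tmul.
Proof.
elim/tensor_ind=> [|s s' hs hs'|a b]; first exact: tmul0l.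
  by rewrite tmulDl hs hs'.
by rewrite tmul_tens !mulr1.
Qed.

HB.instance Definition _ := GRing.Zmodule_isPzRing.Build (A ⨂ B)
  tmulA tmul1l tmul1r tmulDl tmulDr.

End TensorAlgebra.

(* The counit axioms (counit ⊗ id) \o comul = id = (id ⊗ counit) \o comul are  *)
(* read through R ⊗ H = H = H ⊗ R. The target scale of comul is given         *)
(* explicitly because H ⨂ H is only known to be a pzRingType and an lmodType. *)
HB.mixin Record isHopf (R : comNzRingType) H of GRing.Algebra R H := {
  comul : {lrmorphism H -> H ⨂ H | *:%R};
  counit : {lrmorphism H -> R | *%R};
  antipode : {linear H -> H};
  comulA : forall h : H,
    tassoc (tmap comul id (comul h)) = tmap id comul (comul h);
  counitl : forall h : H,
    tlift (fun x y : H => counit x *: y) (comul h) = h;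
  counitr : forall h : H,
    tlift (fun x y : H => counit y *: x) (comul h) = h;
  antipodel : forall h : H,
    tlift (fun x y : H => antipode x * y) (comul h) = (counit h)%:A;
  antipoder : forall h : H,
    tlift (fun x y : H => x * antipode y) (comul h) = (counit h)%:A
}.

#[short(type="hopfAlgType")]
HB.structure Definition HopfAlg (R : comNzRingType) :=
  {H of isHopf R H & GRing.Algebra R H}.

Section MoreTensor.
Context (R : comNzRingType).

Lemma bilin_tlift (U V W X : lmodType R) (T : U -> V -> W -> X) :
    (forall u, bilin (T u)) -> (forall v w, linear (fun u => T u v w)) ->
  bilin (fun u (t : V ⨂ W) => tlift (T u) t).
Proof.
move=> Tb Tl; split=> [t a u u'|u]; last exact: tliftP (Tb u).
rewrite /= /tlift scaler_sumr -big_split /=.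
by apply: eq_bigr => p _; rewrite Tl.
Qed.

Lemma bilin_tliftr (U V W X : lmodType R) (T : U -> V -> W -> X) :
    (forall w, bilin (fun u v => T u v w)) -> (forall u v, linear (T u v)) ->
  bilin (fun (t : U ⨂ V) w => tlift (fun u v => T u v w) t).
Proof.
move=> Tb Tl; split=> [w|t a w w']; first exact: tliftP (Tb w).
rewrite /= /tlift scaler_sumr -big_split /=.
by apply: eq_bigr => p _; rewrite Tl.
Qed.

Lemma tlift_mul (A B : algType R) (W : lmodType R) (f : A -> B -> W)
    (s t : A ⨂ B) : bilin f ->
  tlift f (s * t) = tlift (fun a b => tlift (fun c d => f (a * c) (b * d)) t) s.
Proof.
move=> fb; have fl := tliftP fb.
rewrite [s * t](_ : _ = tmul s t) // /tmul linear_tlift //.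
apply: eq_tlift => a b; rewrite linear_tlift //.
by apply: eq_tlift => c d; rewrite tlift_tens.
Qed.

End MoreTensor.

Section Coassoc.
Context (R : comNzRingType) (H : hopfAlgType R) (W : lmodType R).
Context (T : H -> H -> H -> W).
Hypothesis T1 : forall b c, linear (fun a => T a b c).
Hypothesis T2 : forall a c, linear (fun b => T a b c).
Hypothesis T3 : forall a b, linear (T a b).

Lemma comul_coassoc (h : H) :
  tlift (fun z c => tlift (fun a b => T a b c) (comul z)) (comul h) =
  tlift (fun a z => tlift (fun b c => T a b c) (comul z)) (comul h).
Proof.
have Tb a : bilin (T a) by split=> [c|b]; [exact: T2 | exact: T3].
have PhiB := bilin_tlift Tb T1.
pose Phi := tlift (fun a (t : H ⨂ H) => tlift (T a) t).
have PhiL : linear Phi by exact: tliftP.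
have asB : bilin (fun (t : H ⨂ H) (w : H) =>
    tlift (fun u v => u ⊗ (v ⊗ w)) t : H ⨂ (H ⨂ H)).
  apply: bilin_tliftr => [w|u v].
    split=> [v k u u'|u k v v'].
      exact: (bilinPl (tens_bilin _ _)).
    by rewrite /= (bilinPl (tens_bilin _ _)) (bilinPr (tens_bilin _ _)).
  by move=> k w w'; rewrite !(bilinPr (tens_bilin _ _)).
have asL := tliftP asB.
have := congr1 Phi (comulA h).
rewrite /tmap /tassoc (linear_tlift _ _ asL) (linear_tlift _ _ PhiL).
rewrite (linear_tlift _ _ PhiL) => E.
transitivity (tlift (fun u v => Phi (tlift (fun t w =>
  tlift (fun u0 v0 => u0 ⊗ (v0 ⊗ w)) t) (comul u ⊗ id v))) (comul h)).
  apply: eq_tlift => z c; rewrite (tlift_tens asB) (linear_tlift _ _ PhiL).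
  by apply: eq_tlift => a b; rewrite /Phi (tlift_tens PhiB) (tlift_tens (Tb a)).
rewrite E; apply: eq_tlift => a z.
by rewrite /Phi (tlift_tens PhiB).
Qed.

End Coassoc.

Definition weight (R : comNzRingType) (H : hopfAlgType R) :=
  {lrmorphism H -> R | *%R}.
HB.instance Definition _ (R : comNzRingType) (H : hopfAlgType R) :=
  gen_eqMixin (weight H).
HB.instance Definition _ (R : comNzRingType) (H : hopfAlgType R) :=
  gen_choiceMixin (weight H).

Section Weights.
Context (R : comNzRingType) (H : hopfAlgType R).
Implicit Types (lam nu : weight H) (x y h : H).

Lemma weight_eq lam nu : lam =1 nu -> lam = nu.
Proof.
case: lam nu => [f [[f1] [f2] [f3]]] [g [[g1] [g2] [g3]]] /= /funext e.
by subst g; congr (GRing.LRMorphism.Pack (GRing.LRMorphism.Class _ _ _));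
  [congr GRing.isNmodMorphism.Axioms_ | congr GRing.isMonoidMorphism.Axioms_
  | congr GRing.isScalable.Axioms_]; apply: Prop_irrelevance.
Qed.

Lemma prod_bilin (f g : {linear H -> R | *%R}) :
  bilin (fun x y => f x * g y : R^o).
Proof.
split=> [y a x x'|x a y y'] /=; rewrite linearP /=.
  by rewrite mulrDl -mulrA.
by rewrite mulrDr mulrCA.
Qed.

(* (lam ⊗ nu) \o comul, read through R ⊗ R = R. *)
Definition weight_conv lam nu (h : H) : R :=
  tlift (fun x y => lam x * nu y) (comul h).

Fact weight_conv_linear lam nu : linear_for *%R (weight_conv lam nu).
Proof.
move=> a x y; rewrite /weight_conv linearP /=.
exact: (tliftP (prod_bilin lam nu)).
Qed.

Fact weight_conv_monoid lam nu : monoid_morphism (weight_conv lam nu).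
Proof.
rewrite /weight_conv; split=> [|x y].
  rewrite rmorph1 [1](_ : _ = 1 ⊗ 1) //.
  by rewrite (tlift_tens (prod_bilin lam nu)) !rmorph1 mulr1.
rewrite rmorphM (tlift_mul _ _ (prod_bilin lam nu)) /tlift mulr_suml.
apply: eq_bigr => p _; rewrite mulr_sumr; apply: eq_bigr => q _.
by rewrite !rmorphM mulrACA.
Qed.

HB.instance Definition _ lam nu := GRing.isLinear.Build R H R *%R
  (weight_conv lam nu) (weight_conv_linear lam nu).
HB.instance Definition _ lam nu := GRing.isMonoidMorphism.Build H R
  (weight_conv lam nu) (weight_conv_monoid lam nu).

Definition weight_mul lam nu : weight H := weight_conv lam nu.
Definition weight_one : weight H := counit.

Fact weight_mulA : associative weight_mul.
Proof.
move=> lam nu om; apply: weight_eq => h /=; rewrite /weight_conv.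
transitivity (tlift (fun a z => tlift (fun b c => lam a * nu b * om c : R^o)
    (comul z)) (comul h)).
  apply: eq_bigr => p _; rewrite mulr_sumr.
  by apply: eq_bigr => q _; rewrite mulrA.
rewrite -comul_coassoc.
- by apply: eq_bigr => p _; rewrite mulr_suml.
- by move=> b c k a a'; rewrite linearP /= !mulrDl -!mulrA.
- by move=> a c k b b'; rewrite linearP /= mulrDr mulrDl mulrCA -!mulrA.
- by move=> a b k c c'; rewrite linearP /= mulrDr mulrCA.
Qed.

Fact weight_mul1l : left_id weight_one weight_mul.
Proof.
move=> lam; apply: weight_eq => h /=; rewrite /weight_conv.
rewrite -[in RHS](counitl h) raddf_sum.
by apply: eq_bigr => p _; rewrite /= linearZ.
Qed.

Fact weight_mul1r : right_id weight_one weight_mul.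
Proof.
move=> lam; apply: weight_eq => h /=; rewrite /weight_conv.
rewrite -[in RHS](counitr h) raddf_sum.
by apply: eq_bigr => p _; rewrite /= linearZ mulrC.
Qed.

Definition weight_antipode lam (h : H) : R := lam (antipode h).

Fact weight_antipode_linear lam : linear_for *%R (weight_antipode lam).
Proof. by move=> a x y; rewrite /weight_antipode !linearP. Qed.

HB.instance Definition _ lam := GRing.isLinear.Build R H R *%R
  (weight_antipode lam) (weight_antipode_linear lam).

Lemma weight_antipodel lam h :
  tlift (fun x y => weight_antipode lam x * lam y) (comul h) = counit h.
Proof.
have := congr1 lam (antipodel h); rewrite linearZ /= rmorph1 mulr1 => <-.
by rewrite raddf_sum; apply: eq_bigr => p _; rewrite /= rmorphM.
Qed.

Lemma weight_antipoder lam h :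
  tlift (fun x y => lam x * weight_antipode lam y) (comul h) = counit h.
Proof.
have := congr1 lam (antipoder h); rewrite linearZ /= rmorph1 mulr1 => <-.
by rewrite raddf_sum; apply: eq_bigr => p _; rewrite /= rmorphM.
Qed.

(* lam \o S and (x, y) |-> lam (S x) * lam (S y) are both convolution inverse *)
(* to (x, y) |-> lam (x * y), hence equal.                                    *)
Fact weight_antipode_monoid lam : monoid_morphism (weight_antipode lam).
Proof.
pose mu := weight_antipode lam; rewrite -/mu.
have muP k a b : mu (k *: a + b) = k * mu a + mu b by rewrite /mu linearP.
have lamP k a b : lam (k *: a + b) = k * lam a + lam b by rewrite linearP.
split=> [|x y].
  have := weight_antipodel lam 1.
  rewrite rmorph1 [X in tlift _ X](_ : _ = 1 ⊗ 1) //.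
  rewrite (tlift_tens (prod_bilin (weight_antipode lam) lam)).
  by rewrite !rmorph1 mulr1.
pose T a b b' c d d' : R^o := mu (a * c) * lam (b * d) * (mu b' * mu d').
pose G a b b' : R^o :=
  tlift (fun w d' => tlift (fun c d => T a b b' c d d') (comul w)) (comul y).
have GE a b b' : G a b b' =
  tlift (fun c w => tlift (fun d d' => T a b b' c d d') (comul w)) (comul y).
  rewrite /G (comul_coassoc (T := fun c d d' => T a b b' c d d')) //.
  - by move=> d d' k c c'; rewrite /T mulrDr -scalerAr muP /GRing.scale /=; ring.
  - by move=> c d' k d d1; rewrite /T mulrDr -scalerAr lamP /GRing.scale /=; ring.
  - by move=> c d k d' d1; rewrite /T muP /GRing.scale /=; ring.
have E : tlift (fun z b' => tlift (fun a b => G a b b') (comul z)) (comul x) =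
         tlift (fun a z => tlift (fun b b' => G a b b') (comul z)) (comul x).
  apply: comul_coassoc.
  - move=> b b' k a a'; rewrite /G /tlift scaler_sumr -big_split /=.
    apply: eq_bigr => p _; rewrite scaler_sumr -big_split /=.
    apply: eq_bigr => q _; rewrite /T mulrDl -scalerAl muP /GRing.scale /=.
    by ring.
  - move=> a b' k b b1; rewrite /G /tlift scaler_sumr -big_split /=.
    apply: eq_bigr => p _; rewrite scaler_sumr -big_split /=.
    apply: eq_bigr => q _; rewrite /T mulrDl -scalerAl lamP /GRing.scale /=.
    by ring.
  - move=> a b k b' b1; rewrite /G /tlift scaler_sumr -big_split /=.
    apply: eq_bigr => p _; rewrite scaler_sumr -big_split /=.
    by apply: eq_bigr => q _; rewrite /T muP /GRing.scale /=; ring.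
have L z w : tlift (fun a b => tlift (fun c d => mu (a * c) * lam (b * d))
    (comul w)) (comul z) = counit z * counit w.
  have -> : counit z * counit w = counit (z * w) by rewrite rmorphM.
  rewrite -(weight_antipodel lam (z * w)) rmorphM.
  by rewrite (tlift_mul _ _ (prod_bilin (weight_antipode lam) lam)).
have Rr z w : tlift (fun b b' => tlift (fun d d' =>
    lam (b * d) * (mu b' * mu d')) (comul w)) (comul z) = counit z * counit w.
  rewrite -!(weight_antipoder lam) /tlift mulr_suml; apply: eq_bigr => p _.
  rewrite mulr_sumr; apply: eq_bigr => q _.
  by rewrite rmorphM mulrACA.
have muL z : mu z = tlift (fun a b => counit a * mu b) (comul z).
  rewrite -[in LHS](counitl z) /mu raddf_sum.
  by apply: eq_bigr => p _; rewrite /= linearZ.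
transitivity
  (tlift (fun a z => tlift (fun b b' => G a b b') (comul z)) (comul x)).
  transitivity (tlift (fun a z => tlift (fun c w =>
      mu (a * c) * (counit z * counit w)) (comul y)) (comul x)).
    rewrite -[in LHS](counitr x) -[in LHS](counitr y) /tlift mulr_suml.
    rewrite /mu raddf_sum; apply: eq_bigr => p _; rewrite mulr_sumr raddf_sum.
    apply: eq_bigr => q _; rewrite -scalerAl -scalerAr /weight_antipode.
    by rewrite /= /weight_antipode !linearZ /=; ring.
  apply: eq_bigr => p _; rewrite /tlift; under [RHS]eq_bigr => r _ do rewrite GE.
  rewrite exchange_big /=; apply: eq_bigr => q _; rewrite -Rr /tlift mulr_sumr.
  apply: eq_bigr => r _; rewrite mulr_sumr; apply: eq_bigr => s _.
  by rewrite /T mulrA.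
rewrite -E; transitivity (tlift (fun z b' => tlift (fun w d' =>
    (counit z * counit w) * (mu b' * mu d')) (comul y)) (comul x)).
  apply: eq_bigr => p _; rewrite /G /tlift exchange_big /=.
  apply: eq_bigr => q _; rewrite -L /tlift mulr_suml.
  by apply: eq_bigr => r _; rewrite mulr_suml.
rewrite (muL x) (muL y) /tlift mulr_suml; apply: eq_bigr => p _.
by rewrite mulr_sumr; apply: eq_bigr => q _; rewrite mulrACA.
Qed.

HB.instance Definition _ lam := GRing.isMonoidMorphism.Build H R
  (weight_antipode lam) (weight_antipode_monoid lam).

Definition weight_inv lam : weight H := weight_antipode lam.

Fact weight_mulV : left_inverse weight_one weight_inv weight_mul.
Proof. by move=> lam; apply: weight_eq => h; apply: weight_antipodel. Qed.

Fact weight_mulVr : right_inverse weight_one weight_inv weight_mul.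
Proof. by move=> lam; apply: weight_eq => h; apply: weight_antipoder. Qed.

HB.instance Definition _ := isGroup.Build (weight H)
  weight_mulA weight_mul1l weight_mul1r weight_mulV weight_mulVr.

End Weights.

Section WeightGroup.
Context (R : comNzRingType) (H : hopfAlgType R).
Implicit Types lam nu : weight H.

Lemma weight1E (h : H) : (1%g : weight H) h = counit h.
Proof. by []. Qed.
Lemma weightME lam nu (h : H) :
  (lam * nu)%g h = tlift (fun x y => lam x * nu y) (comul h).
Proof. by []. Qed.
Lemma weightVE lam (h : H) : (lam^-1)%g h = lam (antipode h).
Proof. by []. Qed.

End WeightGroup.

Section Grouplike.
Context (R : comNzRingType) (H : hopfAlgType R).

Definition grouplikes : set H :=
  [set g : H | comul g = g ⊗ g /\ counit g = 1 :> R].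

Definition grouplikes_triv (Pi : {fset weight H}) : set H :=
  [set g | grouplikes g /\ forall gam : weight H, gam \in Pi -> gam g = 1].

Definition weight_sum (Pi : {fset weight H}) (h : H) : R :=
  \sum_(gam <- Pi) gam h.

End Grouplike.

Arguments grouplikes {R} H.

(* Main.v *)
Require Import Defs.
From HB Require Import structures.
From mathcomp Require Import all_boot all_algebra finmap.
From mathcomp Require Import boolp classical_sets.
Import GRing.Theory.
Local Open Scope classical_set_scope.
Local Open Scope ring_scope.

(* For a grouplike g, evaluation at g is a multiplicative character of the weight
   group, so translating Pi by lam multiplies Sigma_Pi(g) by lam(g); if
   lam(g) <> 1 this forces Sigma_Pi(g) = 0 in the integral domain R. *)

(** At a grouplike the coproduct is one pure tensor, so the convolution collapses to a single
    product. *)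
Lemma weight_mul_grouplike (R : comNzRingType) (H : hopfAlgType R)
    (lam nu : weight H) (g : H) :
  grouplikes H g -> (lam * nu)%g g = lam g * nu g.
Proof.
by case=> comul_g _; rewrite weightME comul_g (tlift_tens (prod_bilin lam nu)).
Qed.

Lemma weight_sum_translate (R : comNzRingType) (H : hopfAlgType R)
    (Pi : {fset weight H}) (lam : weight H) (g : H) :
  group_closed (mem Pi) -> lam \in Pi -> grouplikes H g ->
  weight_sum Pi g = lam g * weight_sum Pi g.
Proof.
move=> hPi lamPi hg.
have Pi_mul nu om : nu \in Pi -> om \in Pi -> (nu * om)%g \in Pi.
  exact: group_closedM hPi nu om.
have Pi_inv nu : nu \in Pi -> (nu^-1)%g \in Pi by exact: group_closedV hPi nu.
(* Left translation by [lam] permutes [Pi]: it is injective, and [nu] has the preimage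
   [lam^-1 * nu], again in [Pi]. *)
have lamK : perm_eq [seq (lam * nu)%g | nu <- enum_fset Pi] (enum_fset Pi).
  apply: uniq_perm; rewrite ?(map_inj_uniq (mulgI lam)) ?fset_uniq // => nu.
  apply/mapP/idP => [[om omPi ->]|nuPi]; first exact: (Pi_mul _ _ lamPi omPi).
  exists (lam^-1 * nu)%g; last by rewrite mulVKg.
  exact: (Pi_mul _ _ (Pi_inv _ lamPi) nuPi).
rewrite /weight_sum -[LHS](perm_big _ lamK) big_map mulr_sumr.
by apply: eq_bigr => nu _; rewrite weight_mul_grouplike.
Qed.

Theorem proposition2p8 (R : idomainType) (H : hopfAlgType R)
    (Pi : {fset weight H}) (hPi : group_closed (mem Pi))
    (g : H) (hg : grouplikes H g) :
  ((grouplikes H `\` grouplikes_triv Pi) g -> weight_sum Pi g = 0) /\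
  (grouplikes_triv Pi g -> weight_sum Pi g = #|` Pi|%:R).
Proof.
split=> [[_ gNtriv]|[_ g1]]; last first.
  by rewrite /weight_sum big_seq (eq_bigr (fun=> 1)) // -big_seq big_const_seq count_predT iter_addr_0.
(* As [g] is grouplike, it can only fail to lie in [grouplikes_triv Pi] through some weight of [Pi];
   this is argued classically. *)
have [lam lamPi lamg] : exists2 lam, lam \in Pi & lam g != 1.
  apply: contrapT => noLam; apply: gNtriv; split=> // gam gamPi.
  by apply/eqP; apply: contrapT => /negP gamg; apply: noLam; exists gam.
have /eqP := weight_sum_translate _ _ _ _ _ hPi lamPi hg.
(* Translation invariance becomes [(1 - lam g) * weight_sum Pi g = 0], where the first factor is
   nonzero. *)
rewrite -subr_eq0 -{1}[weight_sum Pi g]mul1r -mulrBl mulf_eq0 subr_eq0 eq_sym.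
by rewrite (negbTE lamg) => /eqP.
Qed.
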